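(* Let $\mathbb F\in\{\mathbb R,\mathbb C\}$ and let $P(\lambda)=\lambda(J_1+R_1)+(J_2+R_2)\in\mathbb F^{n,n}[\lambda]$, where $J_i^*=-J_i$ and $R_i^*=R_i\ge 0$ for $i=1,2$. Let $(x_1,\dots,x_k)$ be a Jordan chain of length $k\ge 2$ of $P(\lambda)$ associated with the eigenvalue $\infty$, and let $\kappa=\lfloor\frac{k+1}{2}\rfloor$. Then $x_1,\dots,x_\kappa\in\ker R_1$ and $x_1,\dots,x_{\kappa-1}\in\ker R_2$; and if $k=2\kappa$ is even, then also $x_\kappa\in\ker R_2$.
   Context: $M^*$ denotes the conjugate transpose, $M\ge 0$ means Hermitian positive semidefinite. A Jordan chain $(x_1,\dots,x_k)$ of $P(\lambda)$ associated with the eigenvalue $\infty$ is a tuple of vectors satisfying $(J_1+R_1)x_1=0$, $(J_1+R_1)x_{i+1}=(J_2+R_2)x_i$ for $i=1,\dots,k-1$, and $(J_2+R_2)x_k\ne 0$. *)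

(* Defs.v *)
From HB Require Import structures.
From mathcomp Require Import all_boot all_order all_algebra.
From mathcomp Require Import reals complex.
Set Implicit Arguments.
Unset Strict Implicit.
Unset Printing Implicit Defensive.
Import Order.TTheory GRing.Theory Num.Theory.
Local Open Scope ring_scope.

Variant scalar_kind := RealScalars | ComplexScalars.

Definition scalars (R : realType) (s : scalar_kind) : numFieldType :=
  match s with
  | RealScalars => R
  | ComplexScalars => R[i]
  end.

Definition scalar_conj (R : realType) (s : scalar_kind) :
    {rmorphism scalars R s -> scalars R s} :=
  match s with
  | RealScalars => idfun
  | ComplexScalars => @Num.conj R[i]
  end.

Definition ctransmx (R : realType) (s : scalar_kind) (m n : nat)
    (M : 'M[scalars R s]_(m, n)) : 'M[scalars R s]_(n, m) :=
  map_mx (scalar_conj R s) M^T.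

(* In R[i], 0 <= z means that z is real and nonnegative. *)
Definition possemidef (R : realType) (s : scalar_kind) (n : nat)
    (M : 'M[scalars R s]_n) : Prop :=
  ctransmx M = M /\
  forall x : 'cV[scalars R s]_n, 0 <= (ctransmx x *m M *m x) 0 0.

Definition mxpencil (F : fieldType) (n : nat) (A B : 'M[F]_n) :
    'M[{poly F}]_n :=
  'X *: map_mx polyC A + map_mx polyC B.

Definition coefmx (F : fieldType) (n : nat) (d : nat) (P : 'M[{poly F}]_n) :
    'M[F]_n :=
  map_mx (fun p : {poly F} => p`_d) P.

(* P is meant to be a pencil, i.e. of degree at most 1.  The chain
   (x_1, ..., x_k) is indexed from 0: x_j is x`_(j - 1). *)
Definition jordan_chain_infty (F : fieldType) (n k : nat)
    (P : 'M[{poly F}]_n) (x : k.-tuple 'cV[F]_n) : Prop :=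
  [/\ coefmx 1 P *m x`_0 = 0,
      forall i : nat, (i.+1 < k)%N ->
        coefmx 1 P *m x`_i.+1 = coefmx 0 P *m x`_i
    & coefmx 0 P *m x`_k.-1 != 0].

(* Main.v *)
Require Import Defs.
From mathcomp Require Import all_boot all_order all_algebra.
From mathcomp Require Import reals complex.
From mathcomp Require Import ring.
From mathcomp Require Import zify.
Import Order.TTheory GRing.Theory Num.Theory.
Local Open Scope ring_scope.

(** Write [E = J1 + R1], [A = J2 + R2] and [y_i = x_(i+1)], so that
    [E y_0 = 0] and [E y_(i+1) = A y_i].  Two facts carry the proof.

    - The form [u^* (J + R) v] is skew-Hermitian up to its [R]-part, so it can
      be flipped, [u^* (J + R) v = - conj (v^* (J + R) u)], as soon as [R]
      kills one of the two vectors ([sform_flip]).  On the diagonal the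
      Hermitian part is the [R]-part, so [u^* (J + R) u = 0] forces
      [u^* R u = 0], hence [R u = 0] by positivity ([ker_of_sform_eq0]).

    - The chain relation turns [E] into [A] while lowering the right index:
      [y_p^* E y_(q+1) = y_p^* A y_q].  If [R1] and [R2] kill [y_q], flipping,
      raising the index and flipping again gives
      [y_p^* E y_(q+1) = y_(p+1)^* E y_q].  Thus one can slide along the
      antidiagonal [p + q] down to [y_(p+q)^* E y_0 = 0], provided that
      [y_(p+q)] still lies in the chain ([chain_sform_eq0]).

    By induction on [m], once [y_0, ..., y_(m-1)] are in both kernels, sliding
    gives [y_m^* E y_m = 0] if [2 m < k], so [R1 y_m = 0]; then
    [y_m^* A y_m = y_m^* E y_(m+1) = - conj (y_(m+1)^* E y_m) = 0] if
    [2 m + 1 < k], so [R2 y_m = 0] ([chain_ker]).  The bounds with [kappa] are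
    these two inequalities. *)

(** * Conjugate transposition *)

Section ConjugateTranspose.
Context {R : realType} {s : scalar_kind}.
Local Notation F := (scalars R s).

Lemma scalar_conjK : involutive (scalar_conj R s).
Proof. by case: s => z //=; exact: conjCK. Qed.

Lemma scalar_conj_mul_ge0 (z : F) : 0 <= scalar_conj R s z * z.
Proof.
case: s z => z /=; first by rewrite -expr2 sqr_ge0.
by rewrite mulrC mul_conjC_ge0.
Qed.

Lemma ctransmxK {m n : nat} (M : 'M[F]_(m, n)) : ctransmx (ctransmx M) = M.
Proof. by apply/matrixP => i j; rewrite !mxE scalar_conjK. Qed.

Lemma ctransmxM {m n p : nat} (M : 'M[F]_(m, n)) (N : 'M[F]_(n, p)) :
  ctransmx (M *m N) = ctransmx N *m ctransmx M.
Proof. by rewrite /ctransmx trmx_mul map_mxM. Qed.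

Lemma ctransmxD {m n : nat} (M N : 'M[F]_(m, n)) :
  ctransmx (M + N) = ctransmx M + ctransmx N.
Proof. by rewrite /ctransmx linearD map_mxD. Qed.

Lemma ctransmxZ {m n : nat} (c : F) (M : 'M[F]_(m, n)) :
  ctransmx (c *: M) = scalar_conj R s c *: ctransmx M.
Proof. by rewrite /ctransmx linearZ map_mxZ. Qed.

Lemma cV_sqnorm_ge0 {n : nat} (u : 'cV[F]_n) : 0 <= (ctransmx u *m u) 0 0.
Proof.
rewrite !mxE sumr_ge0 // => i _.
by rewrite !mxE scalar_conj_mul_ge0.
Qed.

Lemma cV_sqnorm_eq0 {n : nat} (u : 'cV[F]_n) :
  (ctransmx u *m u) 0 0 = 0 -> u = 0.
Proof.
rewrite !mxE => sum0; apply/matrixP => i j; rewrite ord1 [RHS]mxE.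
have ge0 l : true -> 0 <= ctransmx u 0 l * u l 0.
  by move=> _; rewrite !mxE scalar_conj_mul_ge0.
have /eqP := psumr_eq0P ge0 sum0 (i := i) isT.
by rewrite !mxE mulf_eq0 fmorph_eq0 orbb => /eqP.
Qed.

(** * The sesquilinear form of a matrix *)

Definition sform {n : nat} (M : 'M[F]_n) (u v : 'cV[F]_n) : F :=
  (ctransmx u *m (M *m v)) 0 0.

Lemma sform_conj {n : nat} (M : 'M[F]_n) (u v : 'cV[F]_n) :
  scalar_conj R s (sform M u v) = sform (ctransmx M) v u.
Proof.
have -> z : scalar_conj R s ((z : 'M[F]_1) 0 0) = ctransmx z 0 0.
  by rewrite !mxE.
by rewrite !ctransmxM ctransmxK -mulmxA.
Qed.

Lemma sformDm {n : nat} (M N : 'M[F]_n) (u v : 'cV[F]_n) :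
  sform (M + N) u v = sform M u v + sform N u v.
Proof. by rewrite /sform mulmxDl mulmxDr mxE. Qed.

Lemma sformNm {n : nat} (M : 'M[F]_n) (u v : 'cV[F]_n) :
  sform (- M) u v = - sform M u v.
Proof. by rewrite /sform mulNmx mulmxN mxE. Qed.

Lemma sformDl {n : nat} (M : 'M[F]_n) (u u' v : 'cV[F]_n) :
  sform M (u + u') v = sform M u v + sform M u' v.
Proof. by rewrite /sform ctransmxD mulmxDl mxE. Qed.

Lemma sformDr {n : nat} (M : 'M[F]_n) (u v v' : 'cV[F]_n) :
  sform M u (v + v') = sform M u v + sform M u v'.
Proof. by rewrite /sform !mulmxDr mxE. Qed.

Lemma sformZl {n : nat} (M : 'M[F]_n) (c : F) (u v : 'cV[F]_n) :
  sform M (c *: u) v = scalar_conj R s c * sform M u v.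
Proof. by rewrite /sform ctransmxZ -scalemxAl mxE. Qed.

Lemma sformZr {n : nat} (M : 'M[F]_n) (c : F) (u v : 'cV[F]_n) :
  sform M u (c *: v) = c * sform M u v.
Proof. by rewrite /sform -!scalemxAr mxE. Qed.

(** With [a = |Q u|^2] and [b = (Q u)^* Q (Q u)], if [u^* Q u = 0] then the
    form takes the value [- a^2 (b + 2)] at [(b + 1) u - a Q u]; this vector is, up to scaling, a
    step from [u] against the gradient [Q u].  Positivity then leaves only
    [a = 0]. *)
Lemma possemidef_isotropic_ker {n : nat} (Q : 'M[F]_n) (u : 'cV[F]_n) :
  possemidef Q -> sform Q u u = 0 -> Q *m u = 0.
Proof.
move=> [Qh Qge0] uu0; set y := Q *m u.
have form_ge0 v : 0 <= sform Q v v by rewrite /sform mulmxA Qge0.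
set a := sform Q y u; set b := sform Q y y.
have a_ge0 : 0 <= a by exact: cV_sqnorm_ge0.
have b_ge0 : 0 <= b by exact: form_ge0.
have ca : scalar_conj R s a = a.
  rewrite /a /sform -/y !mxE rmorph_sum; apply: eq_bigr => i _.
  by rewrite !mxE rmorphM scalar_conjK mulrC.
have uy : sform Q u y = a by rewrite -{1}Qh -sform_conj.
have cb : scalar_conj R s b = b by rewrite /b sform_conj Qh.
have := form_ge0 ((b + 1) *: u + (- a) *: y).
rewrite sformDl !sformDr !sformZl !sformZr uu0 uy -/a -/b.
rewrite rmorphD rmorph1 rmorphN ca cb.
rewrite (_ : _ + _ = - (a ^+ 2 * (b + 2))); last by ring.
rewrite oppr_ge0 => le0.
have b2_gt0 : 0 < b + 2 by rewrite ltr_wpDl.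
move: le0; rewrite pmulr_lle0 // => a2_le0.
have /eqP : a ^+ 2 == 0 by rewrite eq_le a2_le0 exprn_ge0.
move=> /eqP; rewrite expf_eq0 /= => /eqP a0.
exact: cV_sqnorm_eq0.
Qed.

Section SkewPlusPositive.
Context {n : nat} {J Q : 'M[F]_n}.
Hypotheses (hJ : ctransmx J = - J) (hQ : possemidef Q).

Lemma sform_flip (u v : 'cV[F]_n) :
  Q *m u = 0 -> sform (J + Q) u v = - scalar_conj R s (sform (J + Q) v u).
Proof.
case: hQ => Qh _ Qu0.
have vu0 : sform Q v u = 0 by rewrite /sform Qu0 mulmx0 mxE.
have uv0 : sform Q u v = 0 by rewrite -Qh -sform_conj vu0 rmorph0.
by rewrite !sformDm vu0 uv0 !addr0 sform_conj hJ sformNm opprK.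
Qed.

(** Adding [u^* (J + Q) u = 0] to its conjugate cancels the [J]-part and
    leaves [2 u^* Q u = 0]. *)
Lemma ker_of_sform_eq0 (u : 'cV[F]_n) : sform (J + Q) u u = 0 -> Q *m u = 0.
Proof.
move=> uu0; apply: possemidef_isotropic_ker => //.
have := congr1 (scalar_conj R s) uu0.
case: hQ => Qh _; rewrite sform_conj ctransmxD hJ Qh rmorph0.
move: uu0; rewrite !sformDm sformNm => uu0 cuu0.
have /eqP : sform Q u u *+ 2 = 0 by rewrite -[RHS]addr0 -{1}uu0 -cuu0; ring.
by rewrite mulrn_eq0 => /eqP.
Qed.

End SkewPlusPositive.

(** * Chains of skew-Hermitian plus positive semidefinite pencils *)

Section Chain.
Context {n : nat} {J1 R1 J2 R2 : 'M[F]_n}.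
Hypotheses (hJ1 : ctransmx J1 = - J1) (hJ2 : ctransmx J2 = - J2).
Hypotheses (hR1 : possemidef R1) (hR2 : possemidef R2).
Context {k : nat} {y : nat -> 'cV[F]_n}.
Hypothesis y0 : (J1 + R1) *m y 0 = 0.
Hypothesis yS :
  forall i, (i.+1 < k)%N -> (J1 + R1) *m y i.+1 = (J2 + R2) *m y i.

Lemma sform_chain (u : 'cV[F]_n) (i : nat) :
  (i.+1 < k)%N -> sform (J1 + R1) u (y i.+1) = sform (J2 + R2) u (y i).
Proof. by move=> ik; rewrite /sform yS. Qed.

(** Antidiagonal sliding, by induction on the right index [q]: the step from
    [(p, q + 1)] to [(p + 1, q)] keeps [p + q], hence stays inside the chain,
    and it flips only against [y_q], which [ker] covers. *)
Lemma chain_sform_eq0 {m : nat} :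
    (forall i, (i < m)%N -> R1 *m y i = 0 /\ R2 *m y i = 0) ->
  forall q p, (q <= m)%N -> (p + q < k)%N ->
    sform (J1 + R1) (y p) (y q) = 0.
Proof.
move=> ker; elim=> [|q IHq] p qm pqk; first by rewrite /sform y0 mulmx0 mxE.
have [R1q R2q] := ker q qm.
rewrite sform_chain; last by lia.
(* Swap y_q to the left in A, turn A y_p into E y_(p+1), swap back in E. *)
have -> : sform (J2 + R2) (y p) (y q) =
    - scalar_conj R s (sform (J2 + R2) (y q) (y p)).
  by rewrite (sform_flip hJ2 hR2 (y q)) // rmorphN opprK scalar_conjK.
rewrite -sform_chain; last by lia.
rewrite (sform_flip hJ1 hR1) // rmorphN opprK scalar_conjK.
by apply: IHq; lia.
Qed.

(** The two kernels have to be treated in one induction: sliding down from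
    [y_m] uses both on all earlier vectors, and the second claim for [y_m]
    flips against [y_m] itself, using the first. *)
Lemma chain_ker (m : nat) :
  ((2 * m < k)%N -> R1 *m y m = 0) /\ ((2 * m + 1 < k)%N -> R2 *m y m = 0).
Proof.
elim/ltn_ind: m => m IHm.
have [mk|km] := ltnP (2 * m) k; last by split=> //; lia.
have ker i : (i < m)%N -> R1 *m y i = 0 /\ R2 *m y i = 0.
  by move=> im; have [h1 h2] := IHm i im; split; [apply: h1|apply: h2]; lia.
have R1m : R1 *m y m = 0.
  apply: (ker_of_sform_eq0 hJ1 hR1).
  by apply: (chain_sform_eq0 ker); lia.
split=> // mk1; apply: (ker_of_sform_eq0 hJ2 hR2).
rewrite -sform_chain; last by lia.
rewrite (sform_flip hJ1 hR1) // (chain_sform_eq0 ker) ?rmorph0 ?oppr0 //; lia.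
Qed.

End Chain.

End ConjugateTranspose.

(** * Application to the pencil *)

Lemma coefmx1_mxpencil (F : fieldType) (n : nat) (A B : 'M[F]_n) :
  coefmx 1 (mxpencil A B) = A.
Proof.
by apply/matrixP => i j; rewrite !mxE coefD mulrC coefMX coefC coefC addr0.
Qed.

Lemma coefmx0_mxpencil (F : fieldType) (n : nat) (A B : 'M[F]_n) :
  coefmx 0 (mxpencil A B) = B.
Proof.
by apply/matrixP => i j; rewrite !mxE coefD mulrC coefMX add0r coefC.
Qed.

Theorem theorem4p9 (R : realType) (s : scalar_kind) (n : nat)
    (J1 R1 J2 R2 : 'M[scalars R s]_n)
    (hJ1 : ctransmx J1 = - J1) (hJ2 : ctransmx J2 = - J2)
    (hR1 : possemidef R1) (hR2 : possemidef R2)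
    (k : nat) (hk : (2 <= k)%N) (x : k.-tuple 'cV[scalars R s]_n)
    (hx : jordan_chain_infty (mxpencil (J1 + R1) (J2 + R2)) x)
    (kappa : nat) (hkappa : kappa = ((k + 1) %/ 2)%N) :
  [/\ forall i : nat, (i < kappa)%N -> R1 *m x`_i = 0,
      forall i : nat, (i < kappa.-1)%N -> R2 *m x`_i = 0
    & k = (2 * kappa)%N -> R2 *m x`_kappa.-1 = 0].
Proof.
case: hx => + + _; rewrite coefmx1_mxpencil coefmx0_mxpencil => x0 xS.
have ker := chain_ker hJ1 hJ2 hR1 hR2 (y := fun i => x`_i) x0 xS.
split=> [i ik|i ik|k2].
- by have [+ _] := ker i; apply; lia.
- by have [_ +] := ker i; apply; lia.
- by have [_ +] := ker kappa.-1; apply; lia.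
Qed.
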